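(* Let $A$ be a unital algebra with differential graded algebra $(\Omega,\mathrm d)$ and let $(\nabla,\sigma)$ be a bimodule connection on $\Omega^1$. The third order Leibniz rule $$\nabla_2\nabla\mathrm d(ab)=(\nabla_2\nabla\mathrm da)b+[3,\sigma](\nabla\mathrm da\otimes\mathrm db)+[3,\sigma]'(\mathrm da\otimes\nabla\mathrm db)+a(\nabla_2\nabla\mathrm db)$$ holds for all $a,b\in A$ if and only if the Leibniz-compatibility condition $\nabla_2\sigma_1=\sigma_2\nabla_2$ holds on $\Omega^1\otimes_A\Omega^1$. In this case $\sigma$ obeys the braid relations $\sigma_1\sigma_2\sigma_1=\sigma_2\sigma_1\sigma_2$ on $\Omega^1\otimes_A\Omega^1\otimes_A\Omega^1$, and if $\nabla$ is torsion free and extendable then the curvature $R_\nabla$ is a bimodule map.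
   Context: Everything is over a field. $A$ is a unital algebra and $(\Omega=\oplus_n\Omega^n,\mathrm d)$ is a differential graded algebra with $\Omega^0=A$, product $\wedge$, $\mathrm d^2=0$, graded Leibniz rule and $\Omega$ generated by $A,\mathrm dA$. Lower indices indicate position: $\wedge_i,\sigma_i$ are $\wedge,\sigma$ applied in tensor factors $i,i+1$. A bimodule connection $(\nabla,\sigma)$ on $\Omega^1$ is a linear map $\nabla:\Omega^1\to\Omega^1\otimes_A\Omega^1$ and a bimodule map $\sigma:\Omega^1\otimes_A\Omega^1\to\Omega^1\otimes_A\Omega^1$ with $\nabla(a\omega)=\mathrm da\otimes\omega+a\nabla\omega$, $\nabla(\omega a)=(\nabla\omega)a+\sigma(\omega\otimes\mathrm da)$. $\nabla_2=\nabla\otimes\mathrm{id}+\sigma_1(\mathrm{id}\otimes\nabla):\Omega^1\otimes_A\Omega^1\to\Omega^{1\otimes_A3}$. $[3,\sigma]=\mathrm{id}+\sigma_2+\sigma_1\sigma_2$ and $[3,\sigma]'=\mathrm{id}+\sigma_1+\sigma_2\sigma_1$ on $\Omega^{1\otimes_A3}$. Torsion free: $\wedge\circ\nabla=\mathrm d$ on $\Omega^1$. Extendable: $\omega\otimes\eta\wedge\zeta\mapsto\wedge_1\sigma_2\sigma_1(\omega\otimes\eta\otimes\zeta)$ is a well-defined bimodule map $\Omega^1\otimes_A\Omega^2\to\Omega^2\otimes_A\Omega^1$. Curvature: $R_\nabla=(\mathrm d\otimes\mathrm{id}-\mathrm{id}\wedge\nabla)\nabla:\Omega^1\to\Omega^2\otimes_A\Omega^1$.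 *)

(* Defs.v *)
From HB Require Import structures.
From mathcomp Require Import all_boot all_order all_algebra.
From mathcomp Require Import boolp.

Set Implicit Arguments.
Unset Strict Implicit.
Unset Printing Implicit Defensive.

Import GRing.Theory.
Local Open Scope ring_scope.
Local Open Scope quotient_scope.

Reserved Notation "a ▷ x" (at level 40, left associativity).
Reserved Notation "x ◁ a" (at level 40, left associativity).
Reserved Notation "x ⊗ y" (at level 40, left associativity).

(* Bimodules over a k-algebra A; k acts centrally, in the same way through
   the left action, the right action and the vector space structure. *)

HB.mixin Record Lmodule_isBimodule (k : fieldType) (A : algType k) M
    of GRing.Lmodule k M := {
  lact : A -> M -> M;
  ract : M -> A -> M;
  lact1 : forall x, lact 1 x = x;
  lactA : forall a b x, lact (a * b) x = lact a (lact b x);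
  lactDl : forall a b x, lact (a + b) x = lact a x + lact b x;
  lactDr : forall a x y, lact a (x + y) = lact a x + lact a y;
  lactZ : forall (c : k) a x, lact (c *: a) x = c *: lact a x;
  ract1 : forall x, ract x 1 = x;
  ractA : forall x a b, ract x (a * b) = ract (ract x a) b;
  ractDl : forall x y a, ract (x + y) a = ract x a + ract y a;
  ractDr : forall x a b, ract x (a + b) = ract x a + ract x b;
  ractZ : forall (c : k) x a, ract x (c *: a) = c *: ract x a;
  lractA : forall a x b, ract (lact a x) b = lact a (ract x b)
}.

#[short(type="bimodType")]
HB.structure Definition Bimodule (k : fieldType) (A : algType k) :=
  {M of GRing.Lmodule k M & Lmodule_isBimodule k A M}.

Notation "a ▷ x" := (lact a x) : ring_scope.
Notation "x ◁ a" := (ract x a) : ring_scope.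

Section BimoduleTheory.
Variables (k : fieldType) (A : algType k).

Definition bimodule_map (M N : bimodType A) (f : M -> N) : Prop :=
  [/\ linear f,
      forall a x, f (a ▷ x) = a ▷ f x
    & forall x a, f (x ◁ a) = f x ◁ a].

Variable M : bimodType A.
Implicit Types (a : A) (x : M).

Lemma lactZ1 (c : k) x : c%:A ▷ x = c *: x.
Proof. by rewrite lactZ lact1. Qed.

Lemma ractZ1 (c : k) x : x ◁ c%:A = c *: x.
Proof. by rewrite ractZ ract1. Qed.

Lemma lactZr (c : k) a x : a ▷ (c *: x) = c *: (a ▷ x).
Proof. by rewrite -lactZ1 -lactA -scalerAr mulr1 lactZ. Qed.

Lemma ractZl (c : k) x a : (c *: x) ◁ a = c *: (x ◁ a).
Proof. by rewrite -ractZ1 -ractA -scalerAl mul1r ractZ. Qed.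

Lemma lact0 a : a ▷ (0 : M) = 0.
Proof. by apply: (addrI (a ▷ 0)); rewrite -lactDr !addr0. Qed.

Lemma ract0 a : (0 : M) ◁ a = 0.
Proof. by apply: (addrI (0 ◁ a)); rewrite -ractDl !addr0. Qed.

Lemma lactN a x : a ▷ (- x) = - (a ▷ x).
Proof. by apply: (addrI (a ▷ x)); rewrite -lactDr !subrr lact0. Qed.

Lemma ractN x a : (- x) ◁ a = - (x ◁ a).
Proof. by apply: (addrI (x ◁ a)); rewrite -ractDl !subrr ract0. Qed.

Lemma lact_sum a (I : Type) (r : seq I) (F : I -> M) :
  a ▷ (\sum_(i <- r) F i) = \sum_(i <- r) a ▷ F i.
Proof. by apply: (big_morph _ (lactDr a) (lact0 a)). Qed.

Lemma ract_sum a (I : Type) (r : seq I) (F : I -> M) :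
  (\sum_(i <- r) F i) ◁ a = \sum_(i <- r) F i ◁ a.
Proof. by apply: (big_morph _ (fun x y => ractDl x y a) (ract0 a)). Qed.

End BimoduleTheory.

(* The tensor product over A: a list of pairs (x_i, y_i) stands for the formal
   sum of the x_i ⊗ y_i, and lists are identified along the smallest
   congruence making the sum commutative and ⊗ biadditive and A-balanced.
   Opposites and scalars come from the first factor. *)

Section Tensor.
Variables (k : fieldType) (A : algType k) (M N : bimodType A).
Implicit Types (x : M) (y : N) (a b : A) (c : k) (s t u : seq (M * N)).

Inductive tens_eq : seq (M * N) -> seq (M * N) -> Prop :=
| tens_refl s : tens_eq s s
| tens_sym s t : tens_eq s t -> tens_eq t s
| tens_trans t s u : tens_eq s t -> tens_eq t u -> tens_eq s u
| tens_cat s s' t t' :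
    tens_eq s s' -> tens_eq t t' -> tens_eq (s ++ t) (s' ++ t')
| tens_catC s t : tens_eq (s ++ t) (t ++ s)
| tens_0l y : tens_eq [:: (0, y)] [::]
| tens_Dl x x' y : tens_eq [:: (x + x', y)] [:: (x, y); (x', y)]
| tens_Dr x y y' : tens_eq [:: (x, y + y')] [:: (x, y); (x, y')]
| tens_bal x a y : tens_eq [:: (x ◁ a, y)] [:: (x, a ▷ y)].

Definition tens_rel s t : bool := `[< tens_eq s t >].

Lemma tens_rel_equiv : equiv_class_of tens_rel.
Proof.
split=> [s|s t|t s u].
- by apply/asboolP; apply: tens_refl.
- by apply/asboolP/asboolP; apply: tens_sym.
- by move=> /asboolP h1 /asboolP h2; apply/asboolP; apply: tens_trans h1 h2.
Qed.

Canonical tens_equiv := EquivRelPack tens_rel_equiv.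

Definition tens := {eq_quot tens_equiv}.
HB.instance Definition _ := Choice.on tens.
HB.instance Definition _ := EqQuotient.on tens.

Lemma tensP s t : (\pi_tens s = \pi_tens t) <-> tens_eq s t.
Proof.
split; first by move/eqmodP/asboolP.
by move=> h; apply/eqmodP/asboolP.
Qed.

Lemma tens_quotW (P : tens -> Prop) :
  (forall s, P (\pi_tens s)) -> forall X, P X.
Proof. by move=> h X; rewrite -[X]reprK. Qed.

Lemma tens_reprK s : tens_eq (repr (\pi_tens s)) s.
Proof. by apply/tensP; rewrite reprK. Qed.

Definition tens_op (f : M -> M) (g : N -> N) s := [seq (f p.1, g p.2) | p <- s].

Lemma tens_op_eq f g s t :
    {morph f : x y / x + y} -> {morph g : x y / x + y} ->
    (forall x a, f (x ◁ a) = f x ◁ a) ->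
    (forall a y, g (a ▷ y) = a ▷ g y) ->
  tens_eq s t -> tens_eq (tens_op f g s) (tens_op f g t).
Proof.
move=> fD gD fr gl.
have f0 : f 0 = 0 by apply: (addrI (f 0)); rewrite -fD !addr0.
elim=> [{}s|{}s {}t _|{}t {}s u _ h1 _|{}s s' {}t t' _ h1 _ h2|{}s {}t|y|x x' y
  |x y y'|x a y].
- exact: tens_refl.
- exact: tens_sym.
- exact: tens_trans.
- by rewrite /tens_op !map_cat; apply: tens_cat.
- by rewrite /tens_op !map_cat; apply: tens_catC.
- by rewrite /= f0; apply: tens_0l.
- by rewrite /= fD; apply: tens_Dl.
- by rewrite /= gD; apply: tens_Dr.
- by rewrite /= fr gl; apply: tens_bal.
Qed.

Definition tens_add (X Y : tens) : tens := \pi_tens (repr X ++ repr Y).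
Definition tens_zero : tens := \pi_tens [::].
Definition tens_opp (X : tens) : tens := \pi_tens (tens_op -%R id (repr X)).
Definition tens_scale (c : k) (X : tens) : tens :=
  \pi_tens (tens_op ( *:%R c) id (repr X)).
Definition tens_lact (a : A) (X : tens) : tens :=
  \pi_tens (tens_op (lact a) id (repr X)).
Definition tens_ract (X : tens) (a : A) : tens :=
  \pi_tens (tens_op id (fun y => y ◁ a) (repr X)).

Lemma tens_addE s t : tens_add (\pi_tens s) (\pi_tens t) = \pi_tens (s ++ t).
Proof. by apply/tensP; apply: tens_cat; apply: tens_reprK. Qed.

Lemma tens_oppE s : tens_opp (\pi_tens s) = \pi_tens (tens_op -%R id s).
Proof.
apply/tensP/tens_op_eq => //; last exact: tens_reprK.
- exact: opprD.
- by move=> x a; rewrite ractN.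
Qed.

Lemma tens_scaleE c s :
  tens_scale c (\pi_tens s) = \pi_tens (tens_op ( *:%R c) id s).
Proof.
apply/tensP/tens_op_eq => //; last exact: tens_reprK.
- exact: scalerDr.
- by move=> x a; rewrite ractZl.
Qed.

Lemma tens_lactE a s :
  tens_lact a (\pi_tens s) = \pi_tens (tens_op (lact a) id s).
Proof.
apply/tensP/tens_op_eq => //; last exact: tens_reprK.
- exact: lactDr.
- by move=> x b; rewrite lractA.
Qed.

Lemma tens_ractE s a :
  tens_ract (\pi_tens s) a = \pi_tens (tens_op id (fun y => y ◁ a) s).
Proof.
apply/tensP/tens_op_eq => //; last exact: tens_reprK.
- by move=> x y; rewrite ractDl.
- by move=> b y; rewrite lractA.
Qed.

Lemma tens_addA : associative tens_add.
Proof.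
move=> X Y Z; elim/tens_quotW: X => s; elim/tens_quotW: Y => t.
by elim/tens_quotW: Z => u; rewrite !tens_addE catA.
Qed.

Lemma tens_addC : commutative tens_add.
Proof.
move=> X Y; elim/tens_quotW: X => s; elim/tens_quotW: Y => t.
by rewrite !tens_addE; apply/tensP/tens_catC.
Qed.

Lemma tens_add0 : left_id tens_zero tens_add.
Proof. by move=> X; elim/tens_quotW: X => s; rewrite tens_addE. Qed.

Lemma tens_addN : left_inverse tens_zero tens_opp tens_add.
Proof.
move=> X; elim/tens_quotW: X => s; rewrite tens_oppE tens_addE; apply/tensP.
elim: s => [|[x y] s IH] /=; first exact: tens_refl.
apply: (@tens_trans ([:: (- x, y); (x, y)] ++ (tens_op -%R id s ++ s))).
  rewrite -[X in tens_eq X]/([:: (- x, y)] ++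
    (tens_op -%R id s ++ ([:: (x, y)] ++ s))).
  rewrite -[X in tens_eq _ X]/([:: (- x, y)] ++
    ([:: (x, y)] ++ (tens_op -%R id s ++ s))).
  apply: tens_cat; first exact: tens_refl.
  by rewrite !catA; apply: tens_cat; [apply: tens_catC | apply: tens_refl].
rewrite -[X in tens_eq _ X]/([::] ++ [::]); apply: tens_cat IH.
apply: tens_trans (tens_sym (tens_Dl _ _ _)) _.
by rewrite addNr; apply: tens_0l.
Qed.

HB.instance Definition _ :=
  GRing.isZmodule.Build tens tens_addA tens_addC tens_add0 tens_addN.

Definition tpure x y : tens := \pi_tens [:: (x, y)].

Lemma tens_piE s : \pi_tens s = \sum_(p <- s) tpure p.1 p.2.
Proof.
elim: s => [|[x y] s IH]; first by rewrite big_nil.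
by rewrite big_cons -IH /= -[RHS]/(tens_add _ _) tens_addE.
Qed.

Lemma tpure_sum (X : tens) : X = \sum_(p <- repr X) tpure p.1 p.2.
Proof. by rewrite -tens_piE reprK. Qed.

Lemma tens_ind (P : tens -> Prop) :
    P 0 -> (forall X Y, P X -> P Y -> P (X + Y)) ->
    (forall x y, P (tpure x y)) ->
  forall X, P X.
Proof.
by move=> P0 PD Pp X; rewrite (tpure_sum X); apply: (big_ind P) => // *.
Qed.

Lemma tpureDl x x' y : tpure (x + x') y = tpure x y + tpure x' y.
Proof. by rewrite -[RHS]/(tens_add _ _) tens_addE; apply/tensP/tens_Dl. Qed.

Lemma tpureDr x y y' : tpure x (y + y') = tpure x y + tpure x y'.
Proof. by rewrite -[RHS]/(tens_add _ _) tens_addE; apply/tensP/tens_Dr. Qed.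

Lemma tpure_bal x a y : tpure (x ◁ a) y = tpure x (a ▷ y).
Proof. by apply/tensP/tens_bal. Qed.

Lemma tens_op_comp f g f' g' s :
  tens_op f g (tens_op f' g' s) = tens_op (f \o f') (g \o g') s.
Proof. by rewrite /tens_op -map_comp. Qed.

Lemma tens_op_id f g s : f =1 id -> g =1 id -> tens_op f g s = s.
Proof.
by move=> fE gE; rewrite -[RHS]map_id; apply: eq_map => -[x y]; rewrite fE gE.
Qed.

Lemma tens_op_ext f g f' g' s :
  f =1 f' -> g =1 g' -> tens_op f g s = tens_op f' g' s.
Proof. by move=> fE gE; apply: eq_map => -[x y]; rewrite fE gE. Qed.

Lemma tens_op_cat f g s t :
  tens_op f g (s ++ t) = tens_op f g s ++ tens_op f g t.
Proof. exact: map_cat. Qed.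

Lemma tens_piD s t : \pi_tens (s ++ t) = \pi_tens s + \pi_tens t.
Proof. by rewrite -[RHS]/(tens_add _ _) tens_addE. Qed.

Lemma tens_op_Dl f1 f2 g s : \pi_tens (tens_op (fun x => f1 x + f2 x) g s) =
  \pi_tens (tens_op f1 g s) + \pi_tens (tens_op f2 g s).
Proof.
rewrite !tens_piE !big_map -big_split /=.
by apply: eq_bigr => p _; rewrite tpureDl.
Qed.

Lemma tens_op_Dr f g1 g2 s : \pi_tens (tens_op f (fun y => g1 y + g2 y) s) =
  \pi_tens (tens_op f g1 s) + \pi_tens (tens_op f g2 s).
Proof.
rewrite !tens_piE !big_map -big_split /=.
by apply: eq_bigr => p _; rewrite tpureDr.
Qed.

Lemma tens_scaleA c c' X :
  tens_scale c (tens_scale c' X) = tens_scale (c * c') X.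
Proof.
elim/tens_quotW: X => s; rewrite !tens_scaleE tens_op_comp.
congr (\pi_tens _).
by apply: tens_op_ext => // x /=; rewrite scalerA.
Qed.

Lemma tens_scale1 : left_id 1 tens_scale.
Proof.
move=> X; elim/tens_quotW: X => s; rewrite tens_scaleE tens_op_id // => x.
exact: scale1r.
Qed.

Lemma tens_scaleDr : right_distributive tens_scale +%R.
Proof.
move=> c X Y; elim/tens_quotW: X => s; elim/tens_quotW: Y => t.
by rewrite -tens_piD !tens_scaleE tens_op_cat tens_piD.
Qed.

Lemma tens_scaleDl X : {morph tens_scale^~ X : c c' / c + c'}.
Proof.
elim/tens_quotW: X => s c c'; rewrite !tens_scaleE -tens_op_Dl.
congr (\pi_tens _).
by apply: tens_op_ext => // x; rewrite scalerDl.
Qed.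

HB.instance Definition _ := GRing.Zmodule_isLmodule.Build k tens
  tens_scaleA tens_scale1 tens_scaleDr tens_scaleDl.

Lemma tens_lact1 X : tens_lact 1 X = X.
Proof.
by elim/tens_quotW: X => s; rewrite tens_lactE tens_op_id // => x; apply: lact1.
Qed.

Lemma tens_lactA a b X : tens_lact (a * b) X = tens_lact a (tens_lact b X).
Proof.
elim/tens_quotW: X => s; rewrite !tens_lactE tens_op_comp.
congr (\pi_tens _).
by apply: tens_op_ext => // x; rewrite lactA.
Qed.

Lemma tens_lactDl a b X : tens_lact (a + b) X = tens_lact a X + tens_lact b X.
Proof.
elim/tens_quotW: X => s; rewrite !tens_lactE -tens_op_Dl.
congr (\pi_tens _).
by apply: tens_op_ext => // x; rewrite lactDl.
Qed.

Lemma tens_lactDr a X Y : tens_lact a (X + Y) = tens_lact a X + tens_lact a Y.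
Proof.
elim/tens_quotW: X => s; elim/tens_quotW: Y => t.
by rewrite -tens_piD !tens_lactE tens_op_cat tens_piD.
Qed.

Lemma tens_lactZ c a X : tens_lact (c *: a) X = c *: tens_lact a X.
Proof.
elim/tens_quotW: X => s; rewrite -[RHS]/(tens_scale _ _) !tens_lactE.
rewrite tens_scaleE tens_op_comp.
congr (\pi_tens _).
by apply: tens_op_ext => // x; rewrite lactZ.
Qed.

Lemma tens_ract1 X : tens_ract X 1 = X.
Proof.
by elim/tens_quotW: X => s; rewrite tens_ractE tens_op_id // => x; apply: ract1.
Qed.

Lemma tens_ractA X a b : tens_ract X (a * b) = tens_ract (tens_ract X a) b.
Proof.
elim/tens_quotW: X => s; rewrite !tens_ractE tens_op_comp.
congr (\pi_tens _).
by apply: tens_op_ext => // x; rewrite ractA.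
Qed.

Lemma tens_ractDl X Y a : tens_ract (X + Y) a = tens_ract X a + tens_ract Y a.
Proof.
elim/tens_quotW: X => s; elim/tens_quotW: Y => t.
by rewrite -tens_piD !tens_ractE tens_op_cat tens_piD.
Qed.

Lemma tens_ractDr X a b : tens_ract X (a + b) = tens_ract X a + tens_ract X b.
Proof.
elim/tens_quotW: X => s; rewrite !tens_ractE -tens_op_Dr.
congr (\pi_tens _).
by apply: tens_op_ext => // x; rewrite ractDr.
Qed.

Lemma tpureZ c x y : c *: tpure x y = tpure (c *: x) y.
Proof. by rewrite -[LHS]/(tens_scale _ _) tens_scaleE. Qed.

Lemma tpureZr c x y : c *: tpure x y = tpure x (c *: y).
Proof. by rewrite tpureZ -ractZ1 tpure_bal lactZ1. Qed.

Lemma tens_ractZ c X a : tens_ract X (c *: a) = c *: tens_ract X a.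
Proof.
elim/tens_quotW: X => s; rewrite !tens_ractE !tens_piE !big_map scaler_sumr.
by apply: eq_bigr => p _ /=; rewrite tpureZr ractZ.
Qed.

Lemma tens_lractA a X b :
  tens_ract (tens_lact a X) b = tens_lact a (tens_ract X b).
Proof.
elim/tens_quotW: X => s; rewrite !(tens_lactE, tens_ractE) !tens_op_comp.
by congr (\pi_tens _); apply: tens_op_ext.
Qed.

HB.instance Definition _ := Lmodule_isBimodule.Build k A tens
  tens_lact1 tens_lactA tens_lactDl tens_lactDr tens_lactZ
  tens_ract1 tens_ractA tens_ractDl tens_ractDr tens_ractZ tens_lractA.

Lemma tpure_lact a x y : a ▷ tpure x y = tpure (a ▷ x) y.
Proof. by rewrite -[LHS]/(tens_lact _ _) tens_lactE. Qed.

Lemma tpure_ract x y a : tpure x y ◁ a = tpure x (y ◁ a).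
Proof. by rewrite -[LHS]/(tens_ract _ _) tens_ractE. Qed.

(* tlift f is the additive map x ⊗ y |-> f x y. It is a total operation, and is
   meaningful only when f is biadditive and balanced, see tlift_pure. *)

Definition balanced (V : nmodType) (f : M -> N -> V) : Prop :=
  [/\ forall x x' y, f (x + x') y = f x y + f x' y,
      forall x y y', f x (y + y') = f x y + f x y'
    & forall x a y, f (x ◁ a) y = f x (a ▷ y)].

Definition tlift (V : nmodType) (f : M -> N -> V) (X : tens) : V :=
  \sum_(p <- repr X) f p.1 p.2.

Section TLift.
Variables (V : zmodType) (f : M -> N -> V).
Hypothesis fB : balanced f.

Lemma tlift_pi s : tlift f (\pi_tens s) = \sum_(p <- s) f p.1 p.2.
Proof.
have [fDl fDr fb] := fB.
have f0 y : f 0 y = 0 by apply: (addrI (f 0 y)); rewrite -fDl !addr0.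
suff fE t u : tens_eq t u -> \sum_(p <- t) f p.1 p.2 = \sum_(p <- u) f p.1 p.2.
  exact/fE/tens_reprK.
elim=> [{}t|{}t {}u _ -> //|{}t v {}u _ -> _ //|v v' {}t t' _ IH1 _ IH2|v v'|y
  |x x' y|x y y'|x a y] //.
- by rewrite !big_cat /= IH1 IH2.
- by rewrite !big_cat /= addrC.
- by rewrite big_seq1 big_nil.
- by rewrite !big_cons big_nil !addr0 fDl.
- by rewrite !big_cons big_nil !addr0 fDr.
- by rewrite !big_seq1 fb.
Qed.

Lemma tlift_pure x y : tlift f (tpure x y) = f x y.
Proof. by rewrite tlift_pi big_seq1. Qed.

Lemma tliftD X Y : tlift f (X + Y) = tlift f X + tlift f Y.
Proof.
elim/tens_quotW: X => s; elim/tens_quotW: Y => t.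
by rewrite -tens_piD !tlift_pi big_cat.
Qed.

Lemma tlift0 : tlift f 0 = 0.
Proof. by apply: (addrI (tlift f 0)); rewrite -tliftD !addr0. Qed.

Lemma tlift_unique (g : tens -> V) :
    {morph g : X Y / X + Y} -> (forall x y, g (tpure x y) = f x y) ->
  g =1 tlift f.
Proof.
move=> gD gE; apply: tens_ind => [|X Y|x y].
- by rewrite tlift0; apply: (addrI (g 0)); rewrite -gD !addr0.
- by rewrite gD tliftD => -> ->.
- by rewrite gE tlift_pure.
Qed.

End TLift.

End Tensor.

Arguments tens {k A} M N.
Notation "M ⊗ N" := (tens M%type N%type) : type_scope.
Notation "x ⊗ y" := (tpure x y) : ring_scope.

Section TensorMaps.
Variables (k : fieldType) (A : algType k).

Definition tmap (M N M' N' : bimodType A) (f : M -> M') (g : N -> N') :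
    M ⊗ N -> M' ⊗ N' :=
  tlift (fun x y => f x ⊗ g y).

(* Threefold tensor products are bracketed to the left. *)

Definition tassocl (M N P : bimodType A) :
    M ⊗ (N ⊗ P) -> M ⊗ N ⊗ P :=
  tlift (fun x => tlift (fun y z => x ⊗ y ⊗ z)).

Definition tassocr (M N P : bimodType A) :
    M ⊗ N ⊗ P -> M ⊗ (N ⊗ P) :=
  tlift (fun X z => tlift (fun x y => x ⊗ (y ⊗ z)) X).

Lemma tmap_balanced (M N M' N' : bimodType A) (f : M -> M') (g : N -> N') :
    {morph f : x y / x + y} -> {morph g : x y / x + y} ->
    (forall x a, f (x ◁ a) = f x ◁ a) -> (forall a y, g (a ▷ y) = a ▷ g y) ->
  balanced (fun x y => f x ⊗ g y).
Proof.
move=> fD gD fr gl; split=> *.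
- by rewrite fD tpureDl.
- by rewrite gD tpureDr.
- by rewrite fr gl tpure_bal.
Qed.

Lemma tassocl_balanced1 (M N P : bimodType A) (x : M) :
  balanced (fun (y : N) (z : P) => x ⊗ y ⊗ z).
Proof.
split=> *; first by rewrite tpureDr tpureDl.
- by rewrite tpureDr.
- by rewrite -tpure_ract tpure_bal.
Qed.

Lemma tassocl_balanced (M N P : bimodType A) :
  balanced (fun (x : M) => tlift (fun (y : N) (z : P) => x ⊗ y ⊗ z)).
Proof.
split=> [x x' X|x X Y|x a X].
- elim/tens_ind: X => [|X Y IX IY|y z].
  + by rewrite !tlift0 ?addr0 //; apply: tassocl_balanced1.
  + rewrite !tliftD ?IX ?IY; [exact: addrACA|exact: tassocl_balanced1..].
  + by rewrite !tlift_pure ?tpureDl //; apply: tassocl_balanced1.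
- exact/tliftD/tassocl_balanced1.
- elim/tens_ind: X => [|X Y IX IY|y z].
  + by rewrite lact0 !tlift0 //; apply: tassocl_balanced1.
  + rewrite lactDr !tliftD ?IX ?IY //; exact: tassocl_balanced1.
  + rewrite tpure_lact !tlift_pure ?tpure_bal //; exact: tassocl_balanced1.
Qed.

Lemma tassocl_pure (M N P : bimodType A) (x : M) (y : N) (z : P) :
  tassocl (x ⊗ (y ⊗ z)) = x ⊗ y ⊗ z.
Proof.
rewrite /tassocl tlift_pure; last exact: tassocl_balanced.
by rewrite tlift_pure //; apply: tassocl_balanced1.
Qed.

Lemma tassocr_balanced1 (M N P : bimodType A) (z : P) :
  balanced (fun (x : M) (y : N) => x ⊗ (y ⊗ z)).
Proof.
split=> *; first by rewrite tpureDl.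
- by rewrite tpureDl tpureDr.
- by rewrite tpure_bal tpure_lact.
Qed.

Lemma tassocr_balanced (M N P : bimodType A) :
  balanced (fun X (z : P) => tlift (fun (x : M) (y : N) => x ⊗ (y ⊗ z)) X).
Proof.
split=> [X Y z|X z z'|X a z].
- exact/tliftD/tassocr_balanced1.
- elim/tens_ind: X => [|X Y IX IY|x y].
  + by rewrite !tlift0 ?addr0 //; apply: tassocr_balanced1.
  + rewrite !tliftD ?IX ?IY; [exact: addrACA|exact: tassocr_balanced1..].
  + by rewrite !tlift_pure ?tpureDr //; apply: tassocr_balanced1.
- elim/tens_ind: X => [|X Y IX IY|x y].
  + by rewrite ract0 !tlift0 //; apply: tassocr_balanced1.
  + rewrite ractDl !tliftD ?IX ?IY //; exact: tassocr_balanced1.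
  + rewrite tpure_ract !tlift_pure ?tpure_bal //; exact: tassocr_balanced1.
Qed.

Lemma tassocr_pure (M N P : bimodType A) (x : M) (y : N) (z : P) :
  tassocr (x ⊗ y ⊗ z) = x ⊗ (y ⊗ z).
Proof.
rewrite /tassocr tlift_pure; last exact: tassocr_balanced.
by rewrite tlift_pure //; apply: tassocr_balanced1.
Qed.

End TensorMaps.

(* D is the total algebra, dga_deg D n the subspace Omega^n of D, and dga_iota
   identifies A with Omega^0. *)

Record dga (k : fieldType) (A : algType k) := Dga {
  dga_alg :> algType k;
  dga_deg : nat -> {pred dga_alg};
  dga_iota : {lrmorphism A -> dga_alg};
  dga_d : {linear dga_alg -> dga_alg};
  dga_deg_submod : forall n, submod_closed (dga_deg n);
  dga_degM : forall m n x y,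
    x \in dga_deg m -> y \in dga_deg n -> x * y \in dga_deg (m + n);
  dga_deg_span : forall x, exists n (f : nat -> dga_alg),
    (forall i, f i \in dga_deg i) /\ x = \sum_(i < n) f i;
  dga_deg_direct : forall n (f : nat -> dga_alg),
    (forall i, f i \in dga_deg i) -> \sum_(i < n) f i = 0 ->
    forall i, (i < n)%N -> f i = 0;
  dga_iota_inj : injective dga_iota;
  dga_deg0P : forall x, x \in dga_deg 0 <-> exists a, x = dga_iota a;
  dga_d_deg : forall n x, x \in dga_deg n -> dga_d x \in dga_deg n.+1;
  dga_dd : forall x, dga_d (dga_d x) = 0;
  dga_dM : forall n x y, x \in dga_deg n ->
    dga_d (x * y) = dga_d x * y + (-1) ^+ n * (x * dga_d y);
  dga_gen : forall S : {pred dga_alg}, subalg_closed S ->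
    (forall a, dga_iota a \in S) -> (forall a, dga_d (dga_iota a) \in S) ->
    forall x, x \in S
}.

Arguments dga_deg {k A} D n : rename.
Arguments dga_iota {k A} D : rename.
Arguments dga_d {k A} D : rename.

Section Forms.
Variables (k : fieldType) (A : algType k) (D : dga A).

HB.instance Definition _ n :=
  GRing.isSubmodClosed.Build k D (@dga_deg k A D n) (@dga_deg_submod k A D n).

Definition Omega (n : nat) := {x : dga_alg D | x \in dga_deg D n}.

HB.instance Definition _ n := SubChoice.on (Omega n).
HB.instance Definition _ n := [SubChoice_isSubLmodule of Omega n by <:].

Lemma dga_iota_deg a : dga_iota D a \in dga_deg D 0.
Proof. by apply/dga_deg0P; exists a. Qed.

Lemma Omega_lact_subproof n a (x : Omega n) :
  dga_iota D a * val x \in dga_deg D n.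
Proof. exact: (dga_degM (dga_iota_deg a) (valP x)). Qed.

Lemma Omega_ract_subproof n (x : Omega n) a :
  val x * dga_iota D a \in dga_deg D n.
Proof. by have := dga_degM (valP x) (dga_iota_deg a); rewrite addn0. Qed.

Definition Omega_lact n a (x : Omega n) : Omega n :=
  Sub (dga_iota D a * val x) (Omega_lact_subproof a x).
Definition Omega_ract n (x : Omega n) a : Omega n :=
  Sub (val x * dga_iota D a) (Omega_ract_subproof x a).

Fact Omega_bimod n : Lmodule_isBimodule k A (Omega n).
Proof.
apply: (Lmodule_isBimodule.Build k A (Omega n) (lact := @Omega_lact n)
  (ract := @Omega_ract n)) => *; apply: val_inj => /=;
rewrite ?linearZ /= ?(rmorph1, rmorphM, raddfD, mul1r, mulr1, mulrA, mulrDl) //.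
- by rewrite mulrDr.
- by rewrite scalerAl.
- by rewrite mulrDr.
- by rewrite scalerAr.
Defined.
HB.instance Definition _ n := Omega_bimod n.

Lemma val_lact n a (x : Omega n) : val (a ▷ x) = dga_iota D a * val x.
Proof. by []. Qed.

Lemma val_ract n (x : Omega n) a : val (x ◁ a) = val x * dga_iota D a.
Proof. by []. Qed.

Definition dOmega0 (a : A) : Omega 1 :=
  Sub (dga_d D (dga_iota D a)) (dga_d_deg (dga_iota_deg a)).

Definition dOmega n (x : Omega n) : Omega n.+1 :=
  Sub (dga_d D (val x)) (dga_d_deg (valP x)).

Definition wedge11 (x y : Omega 1) : Omega 2 :=
  Sub (val x * val y) (dga_degM (valP x) (valP y)).

Definition twedge : Omega 1 ⊗ Omega 1 -> Omega 2 := tlift wedge11.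

Definition twedge1 : Omega 1 ⊗ Omega 1 ⊗ Omega 1 -> Omega 2 ⊗ Omega 1 :=
  tmap twedge id.

Lemma wedge11_balanced : balanced wedge11.
Proof.
by split=> *; apply: val_inj; rewrite /= ?(mulrDl, mulrDr) // mulrA.
Qed.

Lemma twedge_pure x y : twedge (x ⊗ y) = wedge11 x y.
Proof. exact/tlift_pure/wedge11_balanced. Qed.

Lemma twedgeD : {morph twedge : X Y / X + Y}.
Proof. exact/tliftD/wedge11_balanced. Qed.

Lemma twedge_ract X a : twedge (X ◁ a) = twedge X ◁ a.
Proof.
elim/tens_ind: X => [|X Y IX IY|x y].
- rewrite ract0 /twedge tlift0 ?ract0 //; exact: wedge11_balanced.
- by rewrite ractDl !twedgeD ractDl IX IY.
- by rewrite tpure_ract !twedge_pure; apply: val_inj; rewrite /= mulrA.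
Qed.

Lemma twedge1_balanced : balanced (fun X (z : Omega 1) => twedge X ⊗ id z).
Proof. by apply: tmap_balanced => //; [exact: twedgeD | exact: twedge_ract]. Qed.

Lemma twedge1_pure X z : twedge1 (X ⊗ z) = twedge X ⊗ z.
Proof. exact/tlift_pure/twedge1_balanced. Qed.

End Forms.

Section Connection.
Variables (k : fieldType) (A : algType k) (D : dga A).
Local Notation Om1 := (Omega D 1).
Variables (nabla : Om1 -> Om1 ⊗ Om1).
Variables (sigma : Om1 ⊗ Om1 -> Om1 ⊗ Om1).

Record bimodule_connection : Prop := BimoduleConnection {
  nabla_linear : linear nabla;
  sigma_bimod : bimodule_map sigma;
  nabla_lact : forall a w, nabla (a ▷ w) = dOmega0 D a ⊗ w + a ▷ nabla w;
  nabla_ract : forall w a, nabla (w ◁ a) = nabla w ◁ a + sigma (w ⊗ dOmega0 D a)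
}.

Definition sigma1 : Om1 ⊗ Om1 ⊗ Om1 -> Om1 ⊗ Om1 ⊗ Om1 :=
  tmap sigma id.

Definition sigma2 (X : Om1 ⊗ Om1 ⊗ Om1) : Om1 ⊗ Om1 ⊗ Om1 :=
  tassocl (tmap id sigma (tassocr X)).

(* The two terms of nabla2 are not balanced separately, only their sum is. *)
Definition nabla2 : Om1 ⊗ Om1 -> Om1 ⊗ Om1 ⊗ Om1 :=
  tlift (fun w z => nabla w ⊗ z + sigma1 (tassocl (w ⊗ nabla z))).

Lemma sigma1_balanced : bimodule_connection ->
  balanced (fun X (z : Om1) => sigma X ⊗ id z).
Proof.
case=> _ [sL _ sr] _ _; apply: tmap_balanced => // X Y.
by rewrite -[X in X + Y]scale1r sL scale1r.
Qed.

Lemma nabla2_balanced : bimodule_connection ->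
  balanced (fun w z => nabla w ⊗ z + sigma1 (tassocl (w ⊗ nabla z))).
Proof.
move=> conn; have [nL _ nl nr] := conn; have sB := sigma1_balanced conn.
have nD : {morph nabla : w z / w + z}.
  by move=> w z; rewrite -[w in w + z]scale1r nL scale1r.
have sD : {morph sigma1 : X Y / X + Y} by exact: tliftD.
have tB := @tassocl_balanced k A Om1 Om1 Om1.
split=> [w w' z|w z z'|w a z].
- by rewrite nD !tpureDl /tassocl (tliftD tB) sD addrACA.
- by rewrite nD !tpureDr /tassocl (tliftD tB) sD addrACA.
- rewrite nr nl tpureDl tpureDr /tassocl (tliftD tB) sD -!/(tassocl _).
  rewrite tassocl_pure {2}/sigma1 [tmap _ _ (_ ⊗ z)]tlift_pure //.
  by rewrite !tpure_bal addrA.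
Qed.

Lemma nabla2_pure w z : bimodule_connection ->
  nabla2 (w ⊗ z) = nabla w ⊗ z + sigma1 (tassocl (w ⊗ nabla z)).
Proof. by move=> conn; apply/tlift_pure/nabla2_balanced. Qed.

(* The braided integers [3,sigma] and [3,sigma]'. *)
Definition brk3 (X : Om1 ⊗ Om1 ⊗ Om1) : Om1 ⊗ Om1 ⊗ Om1 :=
  X + sigma2 X + sigma1 (sigma2 X).

Definition brk3' (X : Om1 ⊗ Om1 ⊗ Om1) : Om1 ⊗ Om1 ⊗ Om1 :=
  X + sigma1 X + sigma2 (sigma1 X).

Definition third_order_leibniz : Prop := forall a b : A,
  nabla2 (nabla (dOmega0 D (a * b))) =
    nabla2 (nabla (dOmega0 D a)) ◁ b + brk3 (nabla (dOmega0 D a) ⊗ dOmega0 D b)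
    + brk3' (tassocl (dOmega0 D a ⊗ nabla (dOmega0 D b)))
    + a ▷ nabla2 (nabla (dOmega0 D b)).

Definition leibniz_compatible : Prop := forall X : Om1 ⊗ Om1,
  nabla2 (sigma X) = sigma2 (nabla2 X).

Definition braid_relation : Prop := forall X : Om1 ⊗ Om1 ⊗ Om1,
  sigma1 (sigma2 (sigma1 X)) = sigma2 (sigma1 (sigma2 X)).

Definition torsion_free : Prop := forall w : Om1, twedge (nabla w) = dOmega w.

Definition extendable : Prop :=
  exists2 s : Om1 ⊗ Omega D 2 -> Omega D 2 ⊗ Om1,
    bimodule_map s & forall w z t : Om1,
      s (w ⊗ wedge11 z t) = twedge1 (sigma2 (sigma1 (w ⊗ z ⊗ t))).

(* d ⊗ id - id ∧ nabla, again balanced only as a whole. *)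
Definition dnabla : Om1 ⊗ Om1 -> Omega D 2 ⊗ Om1 :=
  tlift (fun w z => dOmega w ⊗ z - twedge1 (tassocl (w ⊗ nabla z))).

Lemma dnabla_balanced : bimodule_connection ->
  balanced (fun w z => dOmega w ⊗ z - twedge1 (tassocl (w ⊗ nabla z))).
Proof.
case=> nL _ nl _.
have nD : {morph nabla : w z / w + z}.
  by move=> w z; rewrite -[w in w + z]scale1r nL scale1r.
have sD : {morph @twedge1 k A D : X Y / X + Y}.
  exact/tliftD/twedge1_balanced.
have dD : {morph @dOmega k A D 1 : x y / x + y}.
  by move=> x y; apply: val_inj; rewrite /= raddfD.
have tB := @tassocl_balanced k A Om1 Om1 Om1.
split=> [w w' z|w z z'|w a z].
- by rewrite dD !tpureDl /tassocl (tliftD tB) sD opprD addrACA.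
- by rewrite nD !tpureDr /tassocl (tliftD tB) sD opprD addrACA.
- have -> : dOmega (w ◁ a) = dOmega w ◁ a - wedge11 w (dOmega0 D a).
    apply: val_inj; rewrite /= (dga_dM _ (valP w)) expr1 mulN1r.
    by [].
  rewrite nl tpureDr /tassocl (tliftD tB) sD -!/(tassocl _).
  rewrite tassocl_pure twedge1_pure twedge_pure !tpure_bal.
  rewrite -[- wedge11 _ _]scaleN1r tpureDl -tpureZ scaleN1r tpure_bal.
  by rewrite opprD addrA.
Qed.

Definition curvature (w : Om1) : Omega D 2 ⊗ Om1 := dnabla (nabla w).

End Connection.

(* Main.v *)
Require Import Defs.
From mathcomp Require Import all_boot all_order all_algebra.
From mathcomp Require Import boolp.

Set Implicit Arguments.
Unset Strict Implicit.
Unset Printing Implicit Defensive.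

Import GRing.Theory.

(** Write d for the differential and N for [nabla2]. On the tensor square of
    the 1-forms N is a connection: N (aX) = da ⊗ X + a N X ([nabla2_lact]) and
    N (Xb) = (N X) b + σ1 σ2 (X ⊗ db) ([nabla2_ract]). Everything follows from
    these two rules and from the fact that every 1-form is a sum of terms
    a db ([Omega1_span_exact]), which is how generation of the whole algebra by
    A and dA appears in degree one.

    Third order Leibniz. Apply N ∇ to d(ab) = (da) b + a db and expand. All
    terms of the third order rule appear, and its two sides differ by exactly
    N σ (da ⊗ db) - σ2 N (da ⊗ db). Hence the rule is Leibniz-compatibility on
    the elements da ⊗ db. The defect N σ - σ2 N is left A-linear, because the
    terms da ⊗ X in N (aX) cancel, and the elements da ⊗ db generate the
    tensor square as a left module, so compatibility there is compatibility
    everywhere.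

    Braid relation. Evaluating N σ = σ2 N on Xb with the right rule, the parts
    proportional to b agree, and what remains is
    σ1 σ2 σ1 (X ⊗ db) = σ2 σ1 σ2 (X ⊗ db).

    Curvature. Left linearity comes from dd = 0. For a torsion free connection,
    differentiating wa shows ∧σ = -∧, so d ⊗ id - id ∧ ∇ = ∧1 N
    ([dnabla_nabla2]). The obstruction to right linearity of the curvature is
    ∧1 N σ (w ⊗ da) - ∧1 σ2 (∇w ⊗ da). By compatibility it equals
    ∧1 σ2 σ1 (w ⊗ ∇da), which by extendability depends only on
    w ⊗ ∧∇da = w ⊗ dda = 0. *)

(** * Bimodule maps out of tensor products *)

Section Bimodules.
Local Open Scope ring_scope.
Variables (k : fieldType) (A : algType k).
Implicit Types M N P Q : bimodType A.

Lemma additive0 (U V : zmodType) (f : U -> V) :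
  {morph f : x y / x + y} -> f 0 = 0.
Proof. by move=> fD; apply: (addrI (f 0)); rewrite -fD !addr0. Qed.

Lemma bimodule_mapD M N (f : M -> N) :
  bimodule_map f -> {morph f : x y / x + y}.
Proof. by case=> fL _ _ x y; rewrite -[x in x + y]scale1r fL scale1r. Qed.

Lemma bimodule_mapl M N (f : M -> N) :
  bimodule_map f -> forall a x, f (a ▷ x) = a ▷ f x.
Proof. by case. Qed.

Lemma bimodule_mapr M N (f : M -> N) :
  bimodule_map f -> forall x a, f (x ◁ a) = f x ◁ a.
Proof. by case. Qed.

(** Scalars act through the algebra, so linearity over the field is automatic. *)
Lemma bimodule_map_additive M N (f : M -> N) :
    {morph f : x y / x + y} -> (forall a x, f (a ▷ x) = a ▷ f x) ->
    (forall x a, f (x ◁ a) = f x ◁ a) ->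
  bimodule_map f.
Proof.
by move=> fD fl fr; split=> // c x y; rewrite fD -lactZ1 fl lactZ1.
Qed.

Lemma bimodule_map_id M : bimodule_map (@id M).
Proof. exact: bimodule_map_additive. Qed.

Lemma tens_ext M N (V : zmodType) (f g : M ⊗ N -> V) :
    {morph f : X Y / X + Y} -> {morph g : X Y / X + Y} ->
    (forall x y, f (x ⊗ y) = g (x ⊗ y)) ->
  f =1 g.
Proof.
move=> fD gD fg; elim/tens_ind => [|X Y IX IY|//].
- by rewrite !additive0.
- by rewrite fD gD IX IY.
Qed.

Lemma tpure_additivel M N (y : N) : {morph (fun x : M => x ⊗ y) : x x' / x + x'}.
Proof. by move=> x x'; apply: tpureDl. Qed.

Lemma tpure_additiver M N (x : M) : {morph (fun y : N => x ⊗ y) : y y' / y + y'}.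
Proof. by move=> y y'; apply: tpureDr. Qed.

Lemma tlift_bimodule_map M N P (f : M -> N -> P) :
    balanced f -> (forall a x y, f (a ▷ x) y = a ▷ f x y) ->
    (forall x y a, f x (y ◁ a) = f x y ◁ a) ->
  bimodule_map (tlift f).
Proof.
move=> fB fl fr; have fD := tliftD fB.
apply: bimodule_map_additive => // [a X|X a]; move: X; apply: tens_ext.
- by move=> X Y; rewrite lactDr fD.
- by move=> X Y; rewrite fD lactDr.
- by move=> x y; rewrite tpure_lact !tlift_pure.
- by move=> X Y; rewrite ractDl fD.
- by move=> X Y; rewrite fD ractDl.
- by move=> x y; rewrite tpure_ract !tlift_pure.
Qed.

Lemma tmap_pure M N P Q (f : M -> P) (g : N -> Q) x y :
  bimodule_map f -> bimodule_map g -> tmap f g (x ⊗ y) = f x ⊗ g y.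
Proof.
move=> fm gm; apply: tlift_pure.
by apply: tmap_balanced; [exact: bimodule_mapD..|case: fm|case: gm].
Qed.

Lemma tmap_bimodule_map M N P Q (f : M -> P) (g : N -> Q) :
  bimodule_map f -> bimodule_map g -> bimodule_map (tmap f g).
Proof.
move=> fm gm; apply: tlift_bimodule_map => [|a x y|x y a].
- by apply: tmap_balanced; [exact: bimodule_mapD..|case: fm|case: gm].
- by rewrite (bimodule_mapl fm) tpure_lact.
- by rewrite (bimodule_mapr gm) tpure_ract.
Qed.

Lemma tassocl_bimodule_map M N P : bimodule_map (@tassocl k A M N P).
Proof.
have B := @tassocl_balanced1 k A M N P.
apply: tlift_bimodule_map => [|a x X|x X a]; first exact: tassocl_balanced.
- move: X; apply: tens_ext.
  + exact/tliftD/B.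
  + by move=> X Y; rewrite (tliftD (B _)) lactDr.
  + by move=> y z; rewrite !tlift_pure // !tpure_lact.
- suff -> : tlift (fun y z => x ⊗ y ⊗ z) (X ◁ a) =
            (fun X => tlift (fun y z => x ⊗ y ⊗ z) X ◁ a) X by [].
  move: X; apply: tens_ext.
  + by move=> X Y; rewrite ractDl (tliftD (B _)).
  + by move=> X Y; rewrite (tliftD (B _)) ractDl.
  + by move=> y z; rewrite tpure_ract !tlift_pure // !tpure_ract.
Qed.

Lemma tassocr_bimodule_map M N P : bimodule_map (@tassocr k A M N P).
Proof.
have B := @tassocr_balanced1 k A M N P.
apply: tlift_bimodule_map => [|a X z|X z a]; first exact: tassocr_balanced.
- move: X; apply: tens_ext.
  + by move=> X Y; rewrite lactDr (tliftD (B _)).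
  + by move=> X Y; rewrite (tliftD (B _)) lactDr.
  + by move=> y t; rewrite tpure_lact !tlift_pure // !tpure_lact.
- move: X; apply: tens_ext.
  + exact/tliftD/B.
  + by move=> X Y; rewrite (tliftD (B _)) ractDl.
  + by move=> y t; rewrite !tlift_pure // !tpure_ract.
Qed.

Lemma tassocl_additive M N P : {morph @tassocl k A M N P : X Y / X + Y}.
Proof. exact/bimodule_mapD/tassocl_bimodule_map. Qed.

Lemma tassoclK M N P : cancel (@tassocl k A M N P) (@tassocr k A M N P).
Proof.
have lD := @tassocl_additive M N P.
have rD := bimodule_mapD (@tassocr_bimodule_map M N P).
apply: (tens_ext (g := id)) => // [X Y|x Y]; first by rewrite lD rD.
move: Y; apply: tens_ext => [Y Z|Y Z|y z].
- by rewrite tpureDr lD rD.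
- exact: tpureDr.
- by rewrite tassocl_pure tassocr_pure.
Qed.

End Bimodules.

(** * One-forms are sums of terms a db *)

Section OneForms.
Local Open Scope ring_scope.
Variables (k : fieldType) (A : algType k) (D : dga A).
Local Notation Om1 := (Omega D 1).
Local Notation d := (dOmega0 D).

Lemma dOmega0M a b : d (a * b) = d a ◁ b + a ▷ d b.
Proof.
apply: val_inj => /=.
by rewrite rmorphM (dga_dM _ (dga_iota_deg D a)) expr0 mul1r.
Qed.

Lemma dOmega_lact a (w : Om1) : dOmega (a ▷ w) = wedge11 (d a) w + a ▷ dOmega w.
Proof.
by apply: val_inj; rewrite /= (dga_dM _ (dga_iota_deg D a)) expr0 mul1r.
Qed.

Lemma dOmega_ract (w : Om1) a : dOmega (w ◁ a) = dOmega w ◁ a - wedge11 w (d a).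
Proof. by apply: val_inj; rewrite /= (dga_dM _ (valP w)) expr1 mulN1r. Qed.

Lemma dOmega_dOmega0 a : dOmega (d a) = 0.
Proof. by apply: val_inj; rewrite /= dga_dd. Qed.

(** An inductive predicate, because its elimination principle is the induction
    on 1-forms by which identities are reduced to exact forms. *)
Inductive span_exact : Om1 -> Prop :=
| span_exact0 : span_exact 0
| span_exactD u v : span_exact u -> span_exact v -> span_exact (u + v)
| span_exact_gen a b : span_exact (a ▷ d b).

Lemma span_exact_lact c u : span_exact u -> span_exact (c ▷ u).
Proof.
elim=> [|{}u v _ IHu _ IHv|a b].
- by rewrite lact0; constructor.
- by rewrite lactDr; constructor.
- by rewrite -lactA; constructor.
Qed.

(** The Leibniz rule moves a right factor to the left of the differential. *)
Lemma span_exact_ract u c : span_exact u -> span_exact (u ◁ c).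
Proof.
elim=> [|{}u v _ IHu _ IHv|a b].
- by rewrite ract0; constructor.
- by rewrite ractDl; constructor.
- rewrite lractA -[d b ◁ c](addrK (b ▷ d c)) -dOmega0M -scaleN1r -lactZ1.
  rewrite lactDr -!lactA.
  by do !constructor.
Qed.

(** The ideal of forms of degree at least two, with the degree shifted by two
    so that a decomposition can be completed by terms in degrees 0 and 1. *)
Definition deg_ge2 (x : D) : Prop := exists n (f : nat -> D),
  (forall i, f i \in dga_deg D i.+2) /\ x = \sum_(i < n) f i.

Lemma deg_ge2_0 : deg_ge2 0.
Proof. by exists 0, (fun=> 0); split=> [i|]; rewrite ?rpred0 ?big_ord0. Qed.

Lemma deg_ge2D x y : deg_ge2 x -> deg_ge2 y -> deg_ge2 (x + y).
Proof.
move=> [n [f [fd ->]]] [m [g [gd ->]]].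
exists (n + m)%N, (fun i => (if (i < n)%N then f i else 0) +
                            (if (i < m)%N then g i else 0)); split=> [i|].
  by apply: rpredD; case: ifP; rewrite ?rpred0.
rewrite big_split /=; congr (_ + _); rewrite -big_mkcond /=.
  by rewrite (big_ord_widen _ _ (leq_addr m n)).
by rewrite (big_ord_widen _ _ (leq_addl n m)).
Qed.

Lemma deg_ge2_deg n x : (1 < n)%N -> x \in dga_deg D n -> deg_ge2 x.
Proof.
case: n => [|[|n]] // _ xd; exists n.+1, (fun i => if i == n then x else 0).
split=> [i|]; first by case: eqP => [->|_] //; rewrite rpred0.
rewrite big_ord_recr /= eqxx big1 ?add0r // => i _.
by rewrite ltn_eqF.
Qed.

Lemma deg_ge2_sum n (f : nat -> D) :
  (forall i, (i < n)%N -> deg_ge2 (f i)) -> deg_ge2 (\sum_(i < n) f i).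
Proof.
move=> fh; elim/big_ind: _ => [||i _]; [exact: deg_ge2_0|exact: deg_ge2D|].
exact/fh/ltn_ord.
Qed.

(** Multiplication by an arbitrary form is tested on homogeneous components,
    and cannot lower the degree of any of them. *)
Lemma deg_ge2_mull x y : deg_ge2 x -> deg_ge2 (y * x).
Proof.
have [m [g [gd ->]]] := dga_deg_span y; move=> [n [f [fd ->]]].
rewrite mulr_suml; apply: (deg_ge2_sum (f := fun i => g i * _)) => i _.
rewrite mulr_sumr; apply: (deg_ge2_sum (f := fun j => g i * f j)) => j _.
by apply: deg_ge2_deg (dga_degM (gd i) (fd j)); rewrite !addnS.
Qed.

Lemma deg_ge2_mulr x y : deg_ge2 x -> deg_ge2 (x * y).
Proof.
have [m [g [gd ->]]] := dga_deg_span y; move=> [n [f [fd ->]]].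
rewrite mulr_suml; apply: (deg_ge2_sum (f := fun i => f i * _)) => i _.
rewrite mulr_sumr; apply: (deg_ge2_sum (f := fun j => f i * g j)) => j _.
exact: deg_ge2_deg (dga_degM (fd i) (gd j)).
Qed.

(** The sum of A, the span of the a db, and the ideal of degree at least two. It
    is a subalgebra containing A and dA, hence everything. *)
Definition exact_in_degree1 (x : D) : Prop := exists a (u : Om1) v,
  [/\ span_exact u, deg_ge2 v & x = dga_iota D a + val u + v].

Lemma exact_in_degree1_subalg : subalg_closed [pred x | `[< exact_in_degree1 x >]].
Proof.
split.
- apply/asboolP; exists 1, 0, 0; split; [exact: span_exact0|exact: deg_ge2_0|].
  by rewrite rmorph1 /= !addr0.
- move=> c x y /asboolP[a [u [v [hu hv ->]]]] /asboolP[b [w [t [hw ht ->]]]].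
  apply/asboolP; exists (c *: a + b), (c *: u + w), (c *: v + t); split.
  + by apply: span_exactD => //; rewrite -lactZ1; apply: span_exact_lact.
  + by apply: deg_ge2D => //; rewrite -mulr_algl; apply: deg_ge2_mull.
  + rewrite linearP /= !scalerDr addrACA; congr (_ + _).
    exact: addrACA.
- move=> x y /asboolP[a [u [v [hu hv ->]]]] /asboolP[b [w [t [hw ht ->]]]].
  apply/asboolP; exists (a * b), (a ▷ w + u ◁ b).
  exists (val u * val w + (dga_iota D a + val u) * t
          + v * (dga_iota D b + val w + t)); split.
  + by apply: span_exactD; [apply: span_exact_lact|apply: span_exact_ract].
  + apply: deg_ge2D; last exact: deg_ge2_mulr.
    apply: deg_ge2D; last exact: deg_ge2_mull.
    exact: deg_ge2_deg (dga_degM (valP u) (valP w)).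
  (* In degree 1 the product contributes a w + u b, and all products of two
     terms of positive degree fall into the ideal. *)
  + rewrite /= rmorphM [LHS]mulrDl [in LHS]mulrDr !addrA.
    congr (_ + _ + _); rewrite mulrDr !mulrDl !addrA; congr (_ + _).
    exact: addrAC.
Qed.

(** Since the sum of the degrees is direct, comparing the degree 1 components of
    w = a + u + v identifies w with u. *)
Lemma Omega1_span_exact (w : Om1) : span_exact w.
Proof.
have /asboolP[a [u [v [hu [n [f [fd ->]]] E]]]] :
    val w \in [pred x | `[< exact_in_degree1 x >]].
  apply: (dga_gen exact_in_degree1_subalg) => a; apply/asboolP.
  - exists a, 0, 0; split; [exact: span_exact0|exact: deg_ge2_0|].
    by rewrite /= !addr0.
  - exists 0, (1 ▷ d a), 0; split; [exact: span_exact_gen|exact: deg_ge2_0|].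
    by rewrite raddf0 lact1 add0r addr0.
(* The homogeneous components of (a + u + v) - w. *)
pose g i := if i is i'.+1 then if i' is i''.+1 then f i'' else val (u - w)
            else dga_iota D a.
have gd i : g i \in dga_deg D i.
  by case: i => [|[|i]] //=; [exact: dga_iota_deg|exact: (valP (u - w))].
have : \sum_(i < n.+2) g i = 0.
  rewrite 2!big_ord_recl /= !addrA.
  by rewrite addrAC [X in X - _](_ : _ = val w) ?subrr // E addrAC.
move/(dga_deg_direct gd)/(_ 1%N isT) => /= /eqP; rewrite subr_eq0 => /eqP uw.
by rewrite -(val_inj uw).
Qed.

End OneForms.

(** * Bimodule connections *)

Section Connection.
Local Open Scope ring_scope.
Variables (k : fieldType) (A : algType k) (D : dga A).
Local Notation Om1 := (Omega D 1).
Local Notation d := (dOmega0 D).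
Variables (nabla : Om1 -> Om1 ⊗ Om1) (sigma : Om1 ⊗ Om1 -> Om1 ⊗ Om1).
Hypothesis conn : bimodule_connection nabla sigma.
Local Notation nabla2 := (nabla2 nabla sigma).
Local Notation sigma1 := (sigma1 sigma).
Local Notation sigma2 := (sigma2 sigma).
Local Notation dnabla := (dnabla nabla).

Lemma nabla_additive : {morph nabla : x y / x + y}.
Proof.
by move=> x y; rewrite -[x in x + y]scale1r (nabla_linear conn) scale1r.
Qed.

Lemma sigma1_bimodule_map : bimodule_map sigma1.
Proof.
exact: tmap_bimodule_map (sigma_bimod conn) (bimodule_map_id _).
Qed.

Lemma sigma1_pure X z : sigma1 (X ⊗ z) = sigma X ⊗ z.
Proof. exact: tmap_pure (sigma_bimod conn) (bimodule_map_id _). Qed.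

Let lm := @tassocl_bimodule_map k A Om1 Om1 Om1.
Let rm := @tassocr_bimodule_map k A Om1 Om1 Om1.
Let lD := bimodule_mapD lm.

Lemma sigma2_bimodule_map : bimodule_map sigma2.
Proof.
have mm := tmap_bimodule_map (bimodule_map_id Om1) (sigma_bimod conn).
apply: bimodule_map_additive => [X Y|a X|X a]; rewrite /Defs.sigma2.
- by rewrite (bimodule_mapD rm) (bimodule_mapD mm) lD.
- by rewrite (bimodule_mapl rm) (bimodule_mapl mm) (bimodule_mapl lm).
- by rewrite (bimodule_mapr rm) (bimodule_mapr mm) (bimodule_mapr lm).
Qed.

Lemma sigma2_tassocl w (X : Om1 ⊗ Om1) :
  sigma2 (tassocl (w ⊗ X)) = tassocl (w ⊗ sigma X).
Proof.
rewrite /Defs.sigma2 tassoclK.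
by rewrite (tmap_pure _ _ (bimodule_map_id _) (sigma_bimod conn)).
Qed.

Let s1m := sigma1_bimodule_map.
Let s2m := sigma2_bimodule_map.
Let s1D := bimodule_mapD s1m.
Let s2D := bimodule_mapD s2m.
Let sm := sigma_bimod conn.
Let sD := bimodule_mapD sm.

Lemma nabla2_additive : {morph nabla2 : X Y / X + Y}.
Proof. exact/tliftD/nabla2_balanced. Qed.
Let n2D := nabla2_additive.

Lemma nabla2_lact a X : nabla2 (a ▷ X) = tassocl (d a ⊗ X) + a ▷ nabla2 X.
Proof.
move: X; apply: tens_ext => [X Y|X Y|w z].
- by rewrite lactDr n2D.
- by rewrite tpureDr lD n2D lactDr addrACA.
- rewrite tpure_lact !nabla2_pure // (nabla_lact conn) tpureDl -addrA.
  rewrite tassocl_pure -!tpure_lact (bimodule_mapl lm) (bimodule_mapl s1m).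
  by rewrite lactDr.
Qed.

(** The braiding enters because the derivative of the right factor has to be
    carried leftwards past both legs. *)
Lemma nabla2_ract X b :
  nabla2 (X ◁ b) = nabla2 X ◁ b + sigma1 (sigma2 (X ⊗ d b)).
Proof.
move: X; apply: tens_ext => [X Y|X Y|w z].
- by rewrite ractDl n2D.
- by rewrite tpureDl s2D s1D n2D ractDl addrACA.
- rewrite tpure_ract !nabla2_pure // (nabla_ract conn) tpureDr lD s1D.
  rewrite -tassocl_pure sigma2_tassocl ractDl addrA -!tpure_ract.
  by rewrite (bimodule_mapr lm) (bimodule_mapr s1m).
Qed.

(** The two sides of the third order rule differ by the compatibility defect
    at da ⊗ db. *)
Lemma third_order_leibniz_exact : third_order_leibniz nabla sigma <->
  forall a b, nabla2 (sigma (d a ⊗ d b)) = sigma2 (nabla2 (d a ⊗ d b)).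
Proof.
have E a b : nabla2 (nabla (d (a * b))) =
    nabla2 (nabla (d a)) ◁ b + brk3 sigma (nabla (d a) ⊗ d b)
    + brk3' sigma (tassocl (d a ⊗ nabla (d b))) + a ▷ nabla2 (nabla (d b))
    + (nabla2 (sigma (d a ⊗ d b)) - sigma2 (nabla2 (d a ⊗ d b))).
  rewrite dOmega0M nabla_additive (nabla_ract conn) (nabla_lact conn) !n2D.
  rewrite nabla2_ract nabla2_lact nabla2_pure // s2D /brk3 /brk3'.
  set y := sigma2 (_ ⊗ _); set z := sigma2 (sigma1 _).
  (* Here y + z is σ2 N (da ⊗ db), one summand from each braided integer. *)
  apply: (addIr (y + z)); rewrite -[RHS]addrA subrK !addrA.
  by rewrite [LHS](ACl (1*4*8*2*6*5*9*7*3)).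
split=> H a b; last by rewrite E H subrr addr0.
by apply/subr0_eq/(addrI (nabla2 (nabla (d (a * b))))); rewrite addr0 {1}H -E.
Qed.

(** Coefficients move across the tensor sign, x ⊗ a db = xa ⊗ db, so exact forms
    suffice on the right. *)
Lemma Om1_tens_ext (V : zmodType) (M : bimodType A) (f g : M ⊗ Om1 -> V) :
    {morph f : X Y / X + Y} -> {morph g : X Y / X + Y} ->
    (forall x b, f (x ⊗ d b) = g (x ⊗ d b)) ->
  f =1 g.
Proof.
move=> fD gD fg; apply: tens_ext => // x y; move: x.
elim: (Omega1_span_exact y) => [|u v _ IHu _ IHv|a b] x.
- by rewrite (additive0 (tpure_additiver x)) !additive0.
- by rewrite tpureDr fD gD IHu IHv.
- by rewrite -tpure_bal.
Qed.

(** Both N σ and σ2 N send aX to da ⊗ σX plus a times their value at X, so their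
    difference is left A-linear and vanishes as soon as it does on da ⊗ db. *)
Lemma leibniz_compatible_exact : leibniz_compatible nabla sigma <->
  forall a b, nabla2 (sigma (d a ⊗ d b)) = sigma2 (nabla2 (d a ⊗ d b)).
Proof.
split=> [H a b|H]; first exact: H.
apply: Om1_tens_ext => [X Y|X Y|w b]; [by rewrite sD n2D|by rewrite n2D s2D|].
elim: (Omega1_span_exact w) => [|u v _ IHu _ IHv|c a].
- by rewrite (additive0 (tpure_additivel (d b))) !additive0 // => X Y;
    rewrite ?sD n2D ?s2D.
- by rewrite tpureDl sD !n2D s2D IHu IHv.
- rewrite -tpure_lact (bimodule_mapl sm) !nabla2_lact s2D sigma2_tassocl.
  by rewrite (bimodule_mapl s2m) H.
Qed.

(** Compatibility at Xb exceeds b times compatibility at X by exactly the braid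
    relation at X ⊗ db. *)
Lemma leibniz_compatible_braid :
  leibniz_compatible nabla sigma -> braid_relation sigma.
Proof.
move=> H; apply: Om1_tens_ext => [X Y|X Y|X b].
- by rewrite s1D s2D s1D.
- by rewrite s2D s1D s2D.
- move: (H (X ◁ b)); rewrite (bimodule_mapr sm) !nabla2_ract s2D H.
  by rewrite (bimodule_mapr s2m) sigma1_pure => /addrI.
Qed.

Lemma dnabla_additive : {morph dnabla : X Y / X + Y}.
Proof. exact/tliftD/(dnabla_balanced conn). Qed.

Lemma dnabla_pure w z :
  dnabla (w ⊗ z) = dOmega w ⊗ z - twedge1 (tassocl (w ⊗ nabla z)).
Proof. exact/tlift_pure/(dnabla_balanced conn). Qed.

Let w1D : {morph @twedge1 k A D : X Y / X + Y} := tliftD (twedge1_balanced D).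

Lemma twedge1_ract X a : @twedge1 _ _ D (X ◁ a) = twedge1 X ◁ a.
Proof.
move: X; apply: tens_ext => [X Y|X Y|X z].
- by rewrite ractDl w1D.
- by rewrite w1D ractDl.
- by rewrite tpure_ract !twedge1_pure tpure_ract.
Qed.

(** The failure of right linearity is what the braiding adds to ∇(za), seen
    through the wedge product. *)
Lemma dnabla_ract X a :
  dnabla (X ◁ a) = dnabla X ◁ a - twedge1 (sigma2 (X ⊗ d a)).
Proof.
move: X; apply: tens_ext => [X Y|X Y|w z].
- by rewrite ractDl dnabla_additive.
- by rewrite tpureDl s2D w1D dnabla_additive ractDl opprD addrACA.
- rewrite tpure_ract !dnabla_pure (nabla_ract conn) tpureDr lD w1D opprD addrA.
  rewrite -tassocl_pure sigma2_tassocl ractDl ractN -!tpure_ract.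
  by rewrite (bimodule_mapr lm) twedge1_ract.
Qed.

Lemma twedge1_lact a X : @twedge1 _ _ D (a ▷ X) = a ▷ twedge1 X.
Proof.
move: X; apply: tens_ext => [X Y|X Y|X z].
- by rewrite lactDr w1D.
- by rewrite w1D lactDr.
rewrite tpure_lact !twedge1_pure tpure_lact; congr (_ ⊗ z).
move: X; apply: tens_ext => [X Y|X Y|x y].
- by rewrite lactDr twedgeD.
- by rewrite twedgeD lactDr.
- by rewrite tpure_lact !twedge_pure; apply: val_inj; rewrite /= mulrA.
Qed.

Lemma dnabla_lact a X :
  dnabla (a ▷ X) = twedge1 (tassocl (d a ⊗ X)) + a ▷ dnabla X.
Proof.
move: X; apply: tens_ext => [X Y|X Y|w z].
- by rewrite lactDr dnabla_additive.
- by rewrite tpureDr lD w1D dnabla_additive lactDr addrACA.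
- rewrite tpure_lact !dnabla_pure dOmega_lact tpureDl tassocl_pure.
  rewrite twedge1_pure twedge_pure -addrA -!tpure_lact (bimodule_mapl lm).
  by rewrite twedge1_lact lactDr lactN.
Qed.

(** The derivative of a contributes dda ⊗ w, which vanishes, and two copies of
    da ∧ ∇w with opposite signs. *)
Lemma curvature_lact a w : curvature nabla (a ▷ w) = a ▷ curvature nabla w.
Proof.
rewrite /curvature (nabla_lact conn) dnabla_additive dnabla_pure dnabla_lact.
by rewrite dOmega_dOmega0 (additive0 (tpure_additivel w)) sub0r addKr.
Qed.

(** Compare the two expansions of d(wa), by the graded Leibniz rule and by
    ∧∇(wa). *)
Lemma twedge_sigma X : torsion_free nabla -> twedge (sigma X) = - twedge X.
Proof.
move=> T; move: X; apply: Om1_tens_ext => [X Y|X Y|w a].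
- by rewrite sD twedgeD.
- by rewrite twedgeD opprD.
- have := T (w ◁ a); rewrite (nabla_ract conn) twedgeD twedge_ract T.
  by rewrite dOmega_ract twedge_pure => /addrI.
Qed.

Lemma twedge1_sigma1 X :
  torsion_free nabla -> twedge1 (sigma1 X) = - twedge1 X.
Proof.
move=> T; move: X; apply: tens_ext => [X Y|X Y|X z].
- by rewrite s1D w1D.
- by rewrite w1D opprD.
- rewrite sigma1_pure !twedge1_pure twedge_sigma //.
  by rewrite -!scaleN1r tpureZ.
Qed.

(** The sign ∧1 σ1 = -∧1 turns the sum defining N into the difference defining
    the exterior covariant derivative. *)
Lemma dnabla_nabla2 X : torsion_free nabla -> dnabla X = twedge1 (nabla2 X).
Proof.
move=> T; move: X; apply: tens_ext => [X Y|X Y|w z].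
- exact: dnabla_additive.
- by rewrite n2D w1D.
- by rewrite dnabla_pure nabla2_pure // w1D twedge1_pure T twedge1_sigma1.
Qed.

Lemma extension_twedge (s : Om1 ⊗ Omega D 2 -> Omega D 2 ⊗ Om1) :
    {morph s : X Y / X + Y} ->
    (forall w z t : Om1,
       s (w ⊗ wedge11 z t) = twedge1 (sigma2 (sigma1 (w ⊗ z ⊗ t)))) ->
  forall w X, s (w ⊗ twedge X) = twedge1 (sigma2 (sigma1 (tassocl (w ⊗ X)))).
Proof.
move=> addS sE w; apply: tens_ext => [X Y|X Y|z t].
- by rewrite twedgeD tpureDr addS.
- by rewrite tpureDr lD s1D s2D w1D.
- by rewrite twedge_pure sE tassocl_pure.
Qed.

(** Compatibility turns the obstruction into ∧1 σ2 σ1 (w ⊗ ∇da), and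
    extendability into the value of the extended braiding at w ⊗ dda = 0. *)
Lemma curvature_ract :
    leibniz_compatible nabla sigma -> torsion_free nabla -> extendable sigma ->
  forall w a, curvature nabla (w ◁ a) = curvature nabla w ◁ a.
Proof.
move=> H T [s sbm sE] w a; have addS := bimodule_mapD sbm.
rewrite /curvature (nabla_ract conn) dnabla_additive dnabla_ract.
suff -> : dnabla (sigma (w ⊗ d a)) = twedge1 (sigma2 (nabla w ⊗ d a)).
  by rewrite subrK.
rewrite dnabla_nabla2 // H nabla2_pure // s2D w1D.
rewrite -(extension_twedge addS sE) T dOmega_dOmega0.
by rewrite (additive0 (tpure_additiver w)) (additive0 addS) addr0.
Qed.

Lemma curvature_bimodule_map :
    leibniz_compatible nabla sigma -> torsion_free nabla -> extendable sigma ->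
  bimodule_map (curvature nabla).
Proof.
move=> H T E; apply: bimodule_map_additive.
- by move=> w z; rewrite /curvature nabla_additive dnabla_additive.
- exact: curvature_lact.
- exact: curvature_ract.
Qed.

End Connection.

Theorem lemma3p5 (k : fieldType) (A : algType k) (D : dga A)
    (nabla : Omega D 1 -> Omega D 1 ⊗ Omega D 1)
    (sigma : Omega D 1 ⊗ Omega D 1 -> Omega D 1 ⊗ Omega D 1)
    (conn : bimodule_connection nabla sigma) :
  (third_order_leibniz nabla sigma <-> leibniz_compatible nabla sigma) /\
  (leibniz_compatible nabla sigma ->
     braid_relation sigma /\
     (torsion_free nabla -> extendable sigma -> bimodule_map (curvature nabla))).
Proof.
split=> [|H].
  apply: iff_trans (third_order_leibniz_exact conn) _.
  exact: iff_sym (leibniz_compatible_exact conn).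
split=> [|T E]; first exact: leibniz_compatible_braid conn H.
exact: (curvature_bimodule_map conn).
Qed.
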